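(* Let $\mathcal{H}$ be a real, infinite-dimensional, separable Hilbert space, let $\{\phi_n : n\in\mathbb{N}\}$ be a Parseval frame for $\mathcal{H}$ and let $A\in\mathcal{L}(\mathcal{H})$. Then the following two statements are equivalent: (i) $\{\tfrac{1}{\sqrt2}(\phi_n+iA\phi_n) : n\in\mathbb{N}\}$ is a Parseval frame in $\mathcal{H}+i\mathcal{H}$. (ii) $A$ is unitary and self-adjoint (thus $A^*$ is an isometry).
   Context: $\mathcal{H}+i\mathcal{H}$ is the complexification of the real Hilbert space $\mathcal{H}$: the complex Hilbert space of all $f_r+if_i$ with $f_r,f_i\in\mathcal{H}$ and inner product $\langle f_r+if_i,g_r+ig_i\rangle=\langle f_r,g_r\rangle_{\mathcal{H}}+\langle f_i,g_i\rangle_{\mathcal{H}}+i(\langle f_i,g_r\rangle_{\mathcal{H}}-\langle f_r,g_i\rangle_{\mathcal{H}})$. $\mathcal{L}(\mathcal{H})$ is the space of bounded linear operators $\mathcal{H}\to\mathcal{H}$. A family $\{\phi_n : n\in\mathbb{N}\}$ (repetitions and zero vectors allowed) in a real or complex Hilbert space $X$ is a Parseval frame for $X$ if $\sum_{n\in\mathbb{N}}|\langle f,\phi_n\rangle|^2=\|f\|^2$ for all $f\in X$. An operator $A$ on a real Hilbert space is called unitary if $A^*A=AA^*=\mathrm{Id}$. *)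

(* Defs.v *)
From HB Require Import structures.
From mathcomp Require Import all_boot all_order all_algebra.
From mathcomp Require Import complex ring lra.
From mathcomp Require Import boolp classical_sets functions cardinality reals.
From mathcomp Require Import interval_inference topology normedtype sequences.

Set Implicit Arguments.
Unset Strict Implicit.
Unset Printing Implicit Defensive.

Import Order.TTheory GRing.Theory Num.Theory.
Import numFieldNormedType.Exports.

Local Open Scope classical_set_scope.
Local Open Scope ring_scope.

(* The inner product is linear in its first argument and theta-semilinear in
   the second: theta = idfun gives real Hilbert spaces, and theta = conjugation
   complex ones. *)
HB.mixin Record CompleteNormedModule_isHilbert (K : numFieldType)
    (theta : K -> K) V & CompleteNormedModule K V := {
  inner : {dot V for theta} ;
  innerxx : forall x : V, inner x x = `|x| ^+ 2
}.

#[short(type="hilbertType")]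
HB.structure Definition Hilbert (K : numFieldType) (theta : K -> K) :=
  {V of CompleteNormedModule K V & CompleteNormedModule_isHilbert K theta V}.

Notation realHilbertType R := (hilbertType (@idfun (R : realType))).

Notation "''[' u , v ]" := (inner u%R v%R) : ring_scope.

Section Frames.
Variables (K : numFieldType) (theta : K -> K) (X : hilbertType theta).

Definition parseval_frame (phi : nat -> X) : Prop :=
  forall f : X, series (fun n => `|'[f, phi n]| ^+ 2) @ \oo --> `|f| ^+ 2.

End Frames.

Definition separable (T : topologicalType) : Prop :=
  exists2 D : set T, countable D & dense D.

Definition infinite_dimensional (K : nzRingType) (V : lmodType K) : Prop :=
  ~ exists (n : nat) (e : 'I_n -> V),
      forall v, exists c : 'I_n -> K, v = \sum_(i < n) c i *: e i.

Section RealInner.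
Variables (R : realType) (H : realHilbertType R).
Implicit Types (x y z : H) (a : R).

Lemma innerC x y : '[x, y] = '[y, x].
Proof. by have := hermC inner x y; rewrite expr0 mul1r. Qed.

Lemma innerDl x y z : '[x + y, z] = '[x, z] + '[y, z].
Proof. exact: linearDl. Qed.

Lemma innerZl a x y : '[a *: x, y] = a * '[x, y].
Proof. exact: linearZl_LR. Qed.

Lemma innerDr x y z : '[z, x + y] = '[z, x] + '[z, y].
Proof. by rewrite innerC innerDl !(innerC z). Qed.

Lemma innerZr a x y : '[y, a *: x] = a * '[y, x].
Proof. by rewrite innerC innerZl (innerC y). Qed.

Lemma innerNl x y : '[- x, y] = - '[x, y].
Proof. by rewrite -scaleN1r innerZl mulN1r. Qed.

Lemma innerNr x y : '[x, - y] = - '[x, y].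
Proof. by rewrite innerC innerNl innerC. Qed.

Lemma normD2 x y : `|x + y| ^+ 2 = `|x| ^+ 2 + 2 * '[x, y] + `|y| ^+ 2.
Proof. rewrite -!innerxx !(innerDl, innerDr) (innerC y x); ring. Qed.

Lemma normB2 x y : `|x - y| ^+ 2 = `|x| ^+ 2 - 2 * '[x, y] + `|y| ^+ 2.
Proof. by rewrite normD2 innerNr normrN mulrN. Qed.

Lemma inner_inj x y : (forall z, '[z, x] = '[z, y]) -> x = y.
Proof.
move=> xy; apply/eqP; rewrite -subr_eq0 -normr_eq0 -sqrf_eq0 -innerxx.
by rewrite innerDr innerNr xy subrr.
Qed.

(* The Riesz representation theorem, by minimizing x |-> |x|^2 / 2 - g x. *)
Lemma riesz (g : {linear H -> R}) (M : R) :
  (forall x, `|g x| <= M * `|x|) -> exists z, forall x, g x = '[x, z].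
Proof.
move=> gM; have gZ a x : g (a *: x) = a * g x by rewrite linearZ.
pose J x : R := `|x| ^+ 2 / 2 - g x.
have Jlb x : - (M ^+ 2 / 2) <= J x.
  have := gM x; rewrite /J => /(le_trans (ler_norm _)) h.
  have := sqr_ge0 (`|x| - M); nra.
pose E := range J.
have Einf : has_inf E.
  split; first by exists (J 0), 0.
  by exists (- (M ^+ 2 / 2)) => _ [x _ <-].
pose m := inf E.
have mJ x : m <= J x by apply: ge_inf; [case: Einf | exists x].
have JJ x y : `|x - y| ^+ 2 <= 4 * (J x + J y - 2 * m).
  have := mJ (2^-1 *: (x + y)).
  rewrite /J normB2 normrZ gZ linearD /= ger0_norm ?invr_ge0// exprMn normD2.
  lra.
have /choice[u uP] : forall n : nat, exists x, J x < m + n.+1%:R^-1.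
  move=> n; have n0 : 0 < n.+1%:R^-1 :> R by rewrite invr_gt0.
  by have [_ [x _ <-] ?] := inf_adherent n0 Einf; exists x.
have ucauchy : cauchy (u @ \oo).
  apply: cauchy_exP => e e0.
  have ar (a b p q w k : R) : a < k + p -> b < k + q -> p < w / 8 ->
    q < w / 8 -> 4 * (a + b - 2 * k) < w by lra.
  have e8 : 0 < e ^+ 2 / 8 by rewrite divr_gt0 ?exprn_gt0.
  near \oo => N; exists (u N).
  suff : \forall n \near \oo, ball (u N) e (u n) by [].
  near=> n.
  rewrite -ball_normE /ball_ /= -(@ltr_pXn2r _ 2) ?nnegrE ?(ltW e0)//.
  apply: le_lt_trans (JJ _ _) _.
  have Ne : N.+1%:R^-1 < e ^+ 2 / 8 by near: N; apply: near_infty_natSinv_lt (PosNum e8).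
  have ne : n.+1%:R^-1 < e ^+ 2 / 8 by near: n; apply: near_infty_natSinv_lt (PosNum e8).
  exact: ar (uP N) (uP n) Ne ne.
have /cvg_ex[/= z uz] : cvg (u @ \oo) by exact: cauchy_cvg.
have gcont : continuous g.
  apply: bounded_linear_continuous; apply/linear_boundedP.
  near=> r => x; apply: le_trans (gM x) _; apply: ler_wpM2r => //.
  by near: r; apply: nbhs_pinfty_ge; rewrite num_real.
have Jz : J z <= m.
  have Ju : J (u n) @[n --> \oo] --> J z.
    have h1 : `|u n| ^+ 2 / 2 @[n --> \oo] --> `|z| ^+ 2 / 2.
      by apply: cvgMl; rewrite expr2; apply: cvgM; apply: cvg_norm.
    have h2 : g (u n) @[n --> \oo] --> g z by apply: cvg_comp uz (gcont z).
    exact: cvgB h1 h2.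
  have mu : m + n.+1%:R^-1 @[n --> \oo] --> (m : R).
    rewrite -[X in _ --> X]addr0; apply: cvgD; first exact: cvg_cst.
    exact: cvg_harmonic.
  apply: (ler_cvg_to Ju mu); near=> n; exact/ltW/uP.
exists z => x.
have [->|x0] := eqVneq x 0.
  by rewrite linear0 -(scale0r (0 : H)) innerZl mul0r.
apply/eqP; rewrite -subr_eq0; set c := g x - _.
have k0 : 0 < `|x| ^+ 2 by rewrite exprn_gt0 ?normr_gt0.
have := le_trans Jz (mJ (z + (c / `|x| ^+ 2) *: x)).
rewrite /J normD2 innerZr linearD gZ/= (innerC z) normrZ exprMn (real_normK (num_real _)).
have -> : '[x, z] = g x - c by rewrite /c; ring.
move=> h.
have {h}: c ^+ 2 / `|x| ^+ 2 <= 0.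
  suff : (c / `|x| ^+ 2) ^+ 2 * `|x| ^+ 2 = c ^+ 2 / `|x| ^+ 2 /\
    c / `|x| ^+ 2 * c = c ^+ 2 / `|x| ^+ 2 by move=> [h1 h2]; nra.
  by split; field; rewrite normr_eq0.
rewrite pmulr_lle0 ?invr_gt0// => h.
by rewrite -sqrf_eq0 eq_le h sqr_ge0.
Unshelve. all: by end_near. Qed.

End RealInner.

Section Operators.
Variables (R : realType) (H : realHilbertType R).

Definition bounded_op (A : H -> H) : Prop :=
  exists M : R, forall x, `|A x| <= M * `|x|.

(* The value is a default one when no adjoint exists; see adjointE. *)
Definition adjoint (A : H -> H) (y : H) : H :=
  get [set z | forall x, '[A x, y] = '[x, z]].

Definition self_adjoint (A : H -> H) : Prop := adjoint A =1 A.

Definition unitary (A : H -> H) : Prop :=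
  adjoint A \o A =1 id /\ A \o adjoint A =1 id.

Lemma CauchySchwarz (x y : H) : `|'[x, y]| <= `|x| * `|y|.
Proof.
have [->|y0] := eqVneq y 0.
  by rewrite -(scale0r (0 : H)) innerZr mul0r normr0 mulr_ge0.
have k0 : 0 < `|y| by rewrite normr_gt0.
rewrite -(@ler_pXn2r _ 2) ?nnegrE ?mulr_ge0// (real_normK (num_real _)).
have := sqr_ge0 `|x - ('[x, y] / `|y| ^+ 2) *: y|.
rewrite normB2 innerZr normrZ !exprMn (real_normK (num_real _)) => h.
have k2 : 0 < `|y| ^+ 2 by rewrite exprn_gt0.
suff e : `|x| ^+ 2 * `|y| ^+ 2 - '[x, y] ^+ 2 = `|y| ^+ 2 * (`|x| ^+ 2 -
    2 * ('[x, y] / `|y| ^+ 2 * '[x, y]) +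
    ('[x, y] / `|y| ^+ 2) ^+ 2 * `|y| ^+ 2).
  by rewrite -subr_ge0 e mulr_ge0// ltW.
by field; rewrite normr_eq0.
Qed.

Lemma adjointE (A : {linear H -> H}) : bounded_op A ->
  forall x y, '[A x, y] = '[x, adjoint A y].
Proof.
move=> [M AM] x y.
have lin : linear (fun u : H => '[A u, y] : R).
  by move=> a u v; rewrite linearP innerDl innerZl.
pose L := GRing.isLinear.Build R H R *:%R (fun u : H => '[A u, y] : R) lin.
pose g : {linear H -> R} := HB.pack (fun u : H => '[A u, y] : R) L.
have [|z gz] := @riesz R H g (M * `|y|).
  move=> u; apply: le_trans (CauchySchwarz _ _) _.
  by rewrite mulrAC ler_wpM2r.
by have /(_ x) := @getI H [set z | forall x, '[A x, y] = '[x, z]] z gz.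
Qed.

End Operators.

(* The complexification V + i V; Cplx f g stands for f + i g. *)
Record cplx (V : Type) := Cplx { re_part : V ; im_part : V }.

Section CplxZmodule.
Variable V : zmodType.
Implicit Types f g : cplx V.

Definition cplx_pair f := (re_part f, im_part f).
Definition cplx_of_pair (p : V * V) := Cplx p.1 p.2.
Lemma cplx_pairK : cancel cplx_pair cplx_of_pair. Proof. by case. Qed.
HB.instance Definition _ := Choice.copy (cplx V) (can_type cplx_pairK).

Lemma cplxP f g : re_part f = re_part g -> im_part f = im_part g -> f = g.
Proof. by case: f g => ? ? [? ?] /= -> ->. Qed.

Definition cplx_zero : cplx V := Cplx 0 0.
Definition cplx_opp f := Cplx (- re_part f) (- im_part f).
Definition cplx_add f g :=
  Cplx (re_part f + re_part g) (im_part f + im_part g).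
Lemma cplx_addA : associative cplx_add.
Proof. by move=> f g h; congr Cplx; rewrite addrA. Qed.
Lemma cplx_addC : commutative cplx_add.
Proof. by move=> f g; congr Cplx; rewrite addrC. Qed.
Lemma cplx_add0 : left_id cplx_zero cplx_add.
Proof. by move=> f; apply: cplxP; rewrite /= add0r. Qed.
Lemma cplx_addN : left_inverse cplx_zero cplx_opp cplx_add.
Proof. by move=> f; congr Cplx; rewrite addNr. Qed.
HB.instance Definition _ := GRing.isZmodule.Build (cplx V)
  cplx_addA cplx_addC cplx_add0 cplx_addN.

End CplxZmodule.

Section CplxHilbert.
Variables (R : realType) (H : realHilbertType R).
Local Notation C := R[i].
Implicit Types (f g : cplx H) (a b : C).
Local Notation Re := complex.Re.
Local Notation Im := complex.Im.

Definition cplx_scale a f :=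
  Cplx (Re a *: re_part f - Im a *: im_part f)
       (Re a *: im_part f + Im a *: re_part f).
Lemma cplx_scaleA a b f :
  cplx_scale a (cplx_scale b f) = cplx_scale (a * b) f.
Proof.
case: a b f => [a a'] [b b'] [x y]; apply: cplxP => /=;
  rewrite !(scalerDr, scalerDl, scalerN, scaleNr, scalerA).
  by rewrite !opprD -!addrA; congr (_ + _); rewrite [RHS]addrCA;
    congr (_ + _); rewrite addrC.
by rewrite -!addrA; congr (_ + _); rewrite addrA addrC.
Qed.
Lemma cplx_scale1 : left_id 1 cplx_scale.
Proof.
by move=> f; apply: cplxP; rewrite /= !scale1r scale0r ?subr0 ?addr0.
Qed.
Lemma cplx_scaleDr : right_distributive cplx_scale +%R.
Proof.
move=> a f g; apply: cplxP; rewrite /= !scalerDr ?opprD; exact: addrACA.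
Qed.
Lemma cplx_scaleDl f : {morph cplx_scale^~ f : a b / a + b}.
Proof.
move=> [a a'] [b b']; apply: cplxP; rewrite /= !scalerDl ?opprD;
  exact: addrACA.
Qed.
HB.instance Definition _ := GRing.Zmodule_isLmodule.Build C (cplx H)
  cplx_scaleA cplx_scale1 cplx_scaleDr cplx_scaleDl.

Definition cplx_norm f : C :=
  (Num.sqrt (`|re_part f| ^+ 2 + `|im_part f| ^+ 2))%:C%C.

Lemma cplx_normE f :
  cplx_norm f = `|(Complex `|re_part f| `|im_part f| : C)|.
Proof. by []. Qed.

Lemma cplx_norm_ge0 f : 0 <= cplx_norm f. Proof. by rewrite cplx_normE. Qed.

Lemma cplx_norm2 f :
  cplx_norm f ^+ 2 = (`|re_part f| ^+ 2 + `|im_part f| ^+ 2)%:C%C.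
Proof. by rewrite -rmorphXn sqr_sqrtr// addr_ge0. Qed.

Lemma cplx_normD f g : cplx_norm (f + g) <= cplx_norm f + cplx_norm g.
Proof.
rewrite !cplx_normE; apply: le_trans (ler_normD _ _).
rewrite !normc_def lecR ler_wsqrtr//=.
by rewrite lerD// lerXn2r ?nnegrE ?addr_ge0// ler_normD.
Qed.

Lemma cplx_normZ a f : cplx_norm (a *: f) = `|a| * cplx_norm f.
Proof.
apply/eqP; rewrite -(@eqrXn2 _ 2) ?mulr_ge0 ?cplx_norm_ge0//.
rewrite exprMn !cplx_norm2; case: a => a b; rewrite normc_def /=.
rewrite -rmorphXn sqr_sqrtr ?addr_ge0 ?sqr_ge0// -rmorphM; apply/eqP.
congr (_%:C%C).
rewrite normB2 normD2 !normrZ !innerZl !innerZr !exprMn.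
rewrite !(real_normK (num_real _)) (innerC (im_part f)); ring.
Qed.

Lemma cplx_norm0_eq0 f : cplx_norm f = 0 -> f = 0.
Proof.
move=> /(congr1 (fun z => z ^+ 2)); rewrite cplx_norm2 expr0n/= => -[] /eqP.
rewrite paddr_eq0// !sqrf_eq0 !normr_eq0 => /andP[/eqP f1 /eqP f2].
exact: cplxP.
Qed.

HB.instance Definition _ := Lmodule_isNormed.Build C (cplx H)
  cplx_normD cplx_normZ cplx_norm0_eq0.

Lemma cplx_re_le f : (`|re_part f|)%:C%C <= `|f|.
Proof.
rewrite lecR -[leLHS]ger0_norm// -sqrtr_sqr ler_wsqrtr// lerDl.
exact: sqr_ge0.
Qed.

Lemma cplx_im_le f : (`|im_part f|)%:C%C <= `|f|.
Proof.
rewrite lecR -[leLHS]ger0_norm// -sqrtr_sqr ler_wsqrtr// lerDr.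
exact: sqr_ge0.
Qed.

Lemma cplx_norm_le f : `|f| <= (`|re_part f| + `|im_part f|)%:C%C.
Proof.
rewrite lecR -[leRHS]ger0_norm ?addr_ge0// -sqrtr_sqr ler_wsqrtr// sqrrD.
by rewrite addrAC lerDl mulrn_wge0 ?mulr_ge0.
Qed.

Lemma cplx_complete (F : set_system (cplx H)) :
  ProperFilter F -> cauchy F -> cvg F.
Proof.
move=> FF Fc.
have cp (p : cplx H -> H) : (forall f g, p (f - g) = p f - p g) ->
    (forall f, (`|p f|)%:C%C <= `|f|) -> cvg (p @ F).
  move=> pB pN; apply: cauchy_cvg; apply: cauchy_exP => e e0.
  have /cauchyP /(_ e%:C%C)[|f Ff] := Fc; first by rewrite ltcR.
  exists (p f).
  suff : F [set g | ball (p f) e (p g)] by [].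
  apply: (filterS _ Ff) => g /=.
  rewrite -ball_normE /= => fg.
  have pfg : `|p f - p g| < e.
    by rewrite -pB -ltcR; apply: le_lt_trans (pN _) fg.
  by rewrite -ball_normE.
have /cvg_ex[/= x Fx] := cp (@re_part H) (fun _ _ => erefl) cplx_re_le.
have /cvg_ex[/= y Fy] := cp (@im_part H) (fun _ _ => erefl) cplx_im_le.
apply/cvg_ex; exists (Cplx x y); apply/cvgrPdist_lt => -[e e'].
rewrite ltcE /= => /andP[/eqP -> e0].
have e20 : 0 < e / 2 by rewrite divr_gt0.
move/cvgrPdist_lt : Fx => /(_ _ e20) Fx.
move/cvgrPdist_lt : Fy => /(_ _ e20) Fy.
near=> f; apply: le_lt_trans (cplx_norm_le _) _.
rewrite -[ltRHS]/(e%:C%C) ltcR [e]splitr ltrD//.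
  by near: f.
by near: f.
Unshelve. all: by end_near. Qed.
HB.instance Definition _ := Uniform_isComplete.Build (cplx H) cplx_complete.

Definition cplx_inner f g : C :=
  Complex ('[re_part f, re_part g] + '[im_part f, im_part g])
          ('[im_part f, re_part g] - '[re_part f, im_part g]).

Lemma cplx_innerC f g :
  cplx_inner f g = (-1) ^+ false * Num.conj_op (cplx_inner g f).
Proof.
rewrite expr0 mul1r /= /cplx_inner; congr Complex.
  by rewrite (innerC (re_part f)) (innerC (im_part f)).
by rewrite opprB (innerC (im_part f)) (innerC (re_part f)).
Qed.

Lemma cplx_innerl g : linear_for *%R (cplx_inner ^~ g).
Proof.
move=> [a b] [x y] [x' y']; rewrite /cplx_inner /=; congr Complex => /=;
  rewrite !(innerDl, innerNl, innerZl); ring.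
Qed.

Lemma cplx_innerr f : linear_for (Num.conj_op \; *%R) (cplx_inner f).
Proof.
move=> a g h; rewrite cplx_innerC expr0 mul1r cplx_innerl /=.
by rewrite rmorphD rmorphM/= -!/(Num.conj _) [in RHS]cplx_innerC
  [cplx_inner f h]cplx_innerC !expr0 !mul1r.
Qed.

Lemma cplx_innerxx f : cplx_inner f f = `|f| ^+ 2.
Proof.
rewrite -[`|f|]/(cplx_norm f) cplx_norm2 /cplx_inner !innerxx.
by rewrite (innerC (im_part f)) subrr.
Qed.

Lemma cplx_inner_gt0 f : f != 0 -> 0 < cplx_inner f f.
Proof. by move=> f0; rewrite cplx_innerxx exprn_gt0// normr_gt0. Qed.

HB.instance Definition _ := bilinear_isBilinear.Build C (cplx H) (cplx H) C
  *%R (Num.conj_op \; *%R) cplx_inner (cplx_innerl, cplx_innerr).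
HB.instance Definition _ := isHermitianSesquilinear.Build C (cplx H) false
  Num.conj_op cplx_inner cplx_innerC.
HB.instance Definition _ := isDotProduct.Build C (cplx H) cplx_inner
  cplx_inner_gt0.
HB.instance Definition _ := CompleteNormedModule_isHilbert.Build C
  Num.conj_op (cplx H) cplx_innerxx.

Lemma cplx_split f :
  f = Cplx (re_part f) 0 + Complex 0 1 *: Cplx (im_part f) 0.
Proof.
case: f => x y; apply: cplxP => /=;
  by rewrite ?(scale0r, scaler0, scale1r, subr0, addr0, add0r).
Qed.

Lemma inner_cplxE f g : '[f, g] =
  Complex ('[re_part f, re_part g] + '[im_part f, im_part g])
          ('[im_part f, re_part g] - '[re_part f, im_part g]).
Proof. by []. Qed.

End CplxHilbert.

(* Main.v *)
(* For f = x + iy, |<f, (phi_n + i A phi_n) / sqrt 2>|^2 is half the sum of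
   |<x + A^* y, phi_n>|^2 and |<y - A^* x, phi_n>|^2, so the complex family is a
   Parseval frame iff |x + A^* y|^2 + |y - A^* x|^2 = 2 (|x|^2 + |y|^2) for all
   x, y. Taking y = 0 gives that A^* is isometric; the remaining cross terms then
   say <x, A^* y> = <y, A^* x>, i.e. A^* = A, and a self-adjoint isometry is an
   involution. *)
Require Import Defs.
From HB Require Import structures.
From mathcomp Require Import all_boot all_order all_algebra.
From mathcomp Require Import complex ring lra.
From mathcomp Require Import boolp classical_sets functions cardinality reals.
From mathcomp Require Import topology normedtype sequences.

Set Implicit Arguments.
Unset Strict Implicit.
Unset Printing Implicit Defensive.

Import Order.TTheory GRing.Theory Num.Theory.
Import numFieldNormedType.Exports.

Local Open Scope classical_set_scope.
Local Open Scope ring_scope.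

Local Notation complexNumField R := (R[i] : numFieldType).

(** A positive epsilon of [R[i]] has zero imaginary part, and the embedding of the reals preserves
    distances. *)
Lemma cvg_real_complex (R : realType) (u : nat -> R) (l : R) :
  u @ \oo --> l -> (fun n => (u n)%:C%C : complexNumField R) @ \oo -->
    (l%:C%C : complexNumField R).
Proof.
move=> /cvgrPdist_lt ul; apply/cvgrPdist_lt => -[e e'].
rewrite ltcE /= => /andP[/eqP -> e0].
apply: filterS (ul _ e0) => n une.
by rewrite -rmorphB normc_def /= expr0n addr0 sqrtr_sqr -[ltRHS]/(e%:C%C) ltcR.
Qed.

Section Adjoint.
Variables (R : realType) (H : realHilbertType R).
Variables (A : {linear H -> H}) (A_bounded : bounded_op A).

(** Moving [A] to the other side of the inner products gathers the real and the imaginary part into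
    one inner product with [v] each. *)
Lemma sqr_norm_inner_cplx_graph (f : cplx H) (v : H) :
  `|'[f, (Num.sqrt 2)^-1%:C%C *: Cplx v (A v) : cplx H]| ^+ 2 =
  (2^-1 * (`|'[re_part f + adjoint A (im_part f), v]| ^+ 2 +
           `|'[im_part f - adjoint A (re_part f), v]| ^+ 2))%:C%C :> R[i].
Proof.
have s2 : (Num.sqrt 2)^-1 ^+ 2 = 2^-1 :> R by rewrite exprVn sqr_sqrtr.
rewrite inner_cplxE normc_def -rmorphXn /= sqr_sqrtr ?addr_ge0 ?sqr_ge0//.
congr (_%:C%C).
rewrite !scale0r subr0 addr0 !innerZr !(real_normK (num_real _)).
rewrite !innerDl innerNl -!(innerC (A v)) -!(innerC v).
rewrite !(adjointE A_bounded) -s2; ring.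
Qed.

Lemma cvg_series_cplx_graph (phi : nat -> H) : parseval_frame phi ->
  forall f : cplx H,
  series (fun n =>
    `|'[f, (Num.sqrt 2)^-1%:C%C *: Cplx (phi n) (A (phi n)) : cplx H]| ^+ 2)
  @ \oo --> ((2^-1 * (`|re_part f + adjoint A (im_part f)| ^+ 2 +
      `|im_part f - adjoint A (re_part f)| ^+ 2))%:C%C : complexNumField R).
Proof.
move=> phi_frame f.
rewrite (_ : series _ = fun n => (2^-1 *
    (series (fun n => `|'[re_part f + adjoint A (im_part f), phi n]| ^+ 2) n +
     series (fun n => `|'[im_part f - adjoint A (re_part f), phi n]| ^+ 2) n))%:C%C).
  (* The frame identity of [phi] is used at two vectors, x + A^* y and y - A^* x. *)
  by apply: cvg_real_complex; apply: cvgMr; apply: cvgD; apply: phi_frame.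
apply/funext => n; rewrite /series /= -big_split mulr_sumr rmorph_sum.
by apply: eq_bigr => i _; rewrite sqr_norm_inner_cplx_graph.
Qed.

Lemma parseval_frame_cplx_graph (phi : nat -> H) : parseval_frame phi ->
  parseval_frame
    (fun n => (Num.sqrt 2)^-1%:C%C *: Cplx (phi n) (A (phi n)) : cplx H) <->
  forall x y : H, `|x + adjoint A y| ^+ 2 + `|y - adjoint A x| ^+ 2 =
    2 * (`|x| ^+ 2 + `|y| ^+ 2).
Proof.
move=> phi_frame; have Hcvg := cvg_series_cplx_graph phi_frame.
split=> [frame x y|id_xy f].
  suff : `|x| ^+ 2 + `|y| ^+ 2 = 2^-1 *
      (`|x + adjoint A y| ^+ 2 + `|y - adjoint A x| ^+ 2) by lra.
  apply: complexI; rewrite -(cplx_norm2 (Cplx x y)).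
  (* The same series has two limits, which must agree. *)
  have lim_eq := cvg_unique (@norm_hausdorff _ _) (frame (Cplx x y))
    (Hcvg (Cplx x y)).
  exact: lim_eq.
have <- : (2^-1 * (2 * (`|re_part f| ^+ 2 + `|im_part f| ^+ 2)))%:C%C = `|f| ^+ 2.
  by rewrite mulKf ?pnatr_eq0// -(cplx_norm2 f).
by rewrite -id_xy; apply: Hcvg.
Qed.

Lemma unitary_self_adjointP :
  (forall x y : H, `|x + adjoint A y| ^+ 2 + `|y - adjoint A x| ^+ 2 =
    2 * (`|x| ^+ 2 + `|y| ^+ 2)) <-> unitary A /\ self_adjoint A.
Proof.
have adj := adjointE A_bounded.
split=> [id_xy|[[AsA AAs] sA] x y].
  have iso x : `|adjoint A x| ^+ 2 = `|x| ^+ 2.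
    (* [adjoint] is a chosen value, so it is identified by its inner products. *)
    have adj0 : adjoint A 0 = 0.
      by apply: inner_inj => z; rewrite -adj -(scale0r (0 : H)) !innerZr !mul0r.
    have := id_xy x 0; rewrite adj0 addr0 sub0r normrN normr0; lra.
  have sA : self_adjoint A.
    move=> x; apply: inner_inj => z.
    rewrite (innerC z (A x)) adj.
    (* The squares cancel by [iso], leaving <z, A^* x> = <x, A^* z>. *)
    have := id_xy z x; rewrite normD2 normB2 !iso; lra.
  have AA x : A (A x) = x.
    have isoA u : `|A u| ^+ 2 = `|u| ^+ 2 by rewrite -sA iso.
    (* |A A x - x|^2 = 2 |x|^2 - 2 <A A x, x>, and <A A x, x> = |A x|^2 = |x|^2. *)
    apply/eqP; rewrite -subr_eq0 -normr_eq0 -sqrf_eq0 normB2 !isoA.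
    by rewrite adj sA innerxx isoA; apply/eqP; ring.
  by split=> //; split=> x /=; rewrite sA AA.
have iso z : `|A z| ^+ 2 = `|z| ^+ 2.
  by rewrite -innerxx adj -[adjoint A (A z)]/((adjoint A \o A) z) AsA innerxx.
(* The cross terms 2 <x, A y> and -2 <y, A x> cancel by self-adjointness. *)
rewrite normD2 normB2 !sA !iso (innerC y) adj sA; ring.
Qed.

End Adjoint.

Theorem theorem3p37 (R : realType) (H : realHilbertType R)
    (Hinf : infinite_dimensional H) (Hsep : separable H)
    (phi : nat -> H) (phi_frame : parseval_frame phi)
    (A : {linear H -> H}) (A_bounded : bounded_op A) :
  (parseval_frame
     (fun n => (Num.sqrt 2)^-1%:C%C *: Cplx (phi n) (A (phi n)) : cplx H)
   <-> unitary A /\ self_adjoint A)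
  /\ (unitary A /\ self_adjoint A -> forall x : H, `|adjoint A x| = `|x|).
Proof.
split; first by rewrite parseval_frame_cplx_graph// unitary_self_adjointP.
move=> [[_ AAs] _] x; apply/eqP.
(* |A^* x|^2 = <A A^* x, x>, and A A^* = Id. *)
rewrite -(@eqrXn2 _ 2)// -!innerxx -adjointE//.
by rewrite -[A (adjoint A x)]/((A \o adjoint A) x) AAs.
Qed.
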